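(* Let $n,a,b,c,d$ be nonnegative integers with $a\ge 1$. Let $\lambda=((n+b+c)^{n+a},(n+c)^{d})$ (i.e. $n+a$ rows of length $n+b+c$ followed by $d$ rows of length $n+c$), let $\mu=(c+1,c^{a-1},1)$, and let $\rho=\lambda/\mu$. Then the number $f^\rho$ of standard Young tableaux of shape $\rho$ is \[ f^\rho = |\rho|!\, \frac{\Phi(n)\Phi(a)\Phi(b)\Phi(c)\Phi(d)\Phi(n+a+c)\Phi(n+b+d)\Phi(n+a+b+c+d)}{\Phi(a+c)\Phi(b+d)\Phi(n+a+b)\Phi(n+c+d)\Phi(2n+a+b+c+d)} \] \[ \times \frac{ac \big( n(n+a+b+c+d)(n(n+a+b+c+d)+(a+c)(b+d))+bd (a+c-1)(a+c +1) \big)}{(a+c-1)(a+c +1)}. \]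
   Context: For a nonnegative integer $k$, $\Phi(k)=\prod_{i=1}^{k-1} i!$ (an empty product equals $1$). Partitions are written with exponent notation for repeated parts, e.g. $(x^k)$ means $k$ parts equal to $x$. Partitions are identified with their Young diagrams $\{(i,j): 1\le i\le \ell(\lambda), 1\le j\le\lambda_i\}$ (English convention), and for $\mu\subseteq\lambda$ the skew shape $\lambda/\mu$ is the set difference of the diagrams; $|\rho|$ is its number of cells. A standard Young tableau of shape $\rho$ is a filling of the cells of $\rho$ with $1,2,\dots,|\rho|$, each used once, increasing along each row and down each column.
   Formalization: It is assumed that μ is a partition (this fails for c=0, a≥2) and that μ⊆λ, so that ρ is defined; at (a,c)=(1,0), where the printed factor ac/((a+c−1)(a+c+1)) is 0/0, it is replaced by 1/(a+c+1). *)

(* Defs.v *)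
From mathcomp Require Export all_boot all_order all_algebra finmap.

Set Implicit Arguments.
Unset Strict Implicit.
Unset Printing Implicit Defensive.

Definition Phi (k : nat) : nat := \prod_(1 <= i < k) i`!.

(* Trailing zero parts are allowed: they contribute no cells. *)
Definition is_partition (s : seq nat) : bool := sorted geq s.

(* Cells (i, j) are numbered from 1; part i of s is [nth 0 s i.-1]. *)
Definition diagram (s : seq nat) : {fset nat * nat} :=
  [fset x in [seq (i, j) | i <- iota 1 (size s), j <- iota 1 (nth 0 s i.-1)]]%fset.

Definition skew_shape (la mu : seq nat) : {fset nat * nat} :=
  (diagram la `\` diagram mu)%fset.

(* The entry of the cell x is [(T x).+1], so that entries range over
   1, ..., |rho|. *)
Definition is_SYT (rho : {fset nat * nat}) (T : {ffun rho -> 'I_#|` rho|}) : bool :=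
  [&& [forall k : 'I_#|` rho|, #|[pred x : rho | T x == k]| == 1],
      [forall x : rho, forall y : rho,
         ((val x).1 == (val y).1) && ((val x).2 < (val y).2) ==> (T x < T y)]
    & [forall x : rho, forall y : rho,
         ((val x).2 == (val y).2) && ((val x).1 < (val y).1) ==> (T x < T y)]].

Definition num_SYT (rho : {fset nat * nat}) : nat :=
  #|[set T : {ffun rho -> 'I_#|` rho|} | is_SYT T]|.

(* ((n+b+c)^(n+a), (n+c)^d) *)
Definition lambda_shape (n a b c d : nat) : seq nat :=
  nseq (n + a) (n + b + c) ++ nseq d (n + c).

(* (c+1, c^(a-1), 1), for a >= 1 *)
Definition mu_shape (a c : nat) : seq nat :=
  c.+1 :: nseq a.-1 c ++ [:: 1].

Local Open Scope ring_scope.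

Definition Phi_quotient (n a b c d : nat) : rat :=
  (Phi n * Phi a * Phi b * Phi c * Phi d * Phi (n + a + c) * Phi (n + b + d)
     * Phi (n + a + b + c + d))%:R
  / (Phi (a + c) * Phi (b + d) * Phi (n + a + b) * Phi (n + c + d)
     * Phi (2 * n + a + b + c + d))%:R.

Definition quartic_factor (n a b c d : nat) : rat :=
  let s := (n + a + b + c + d)%N in
  (n * s * (n * s + (a + c) * (b + d)))%:R
  + (b * d)%:R * ((a + c)%:R - 1) * ((a + c)%:R + 1).

(* Main.v *)
(* Aitken's determinant |rho|! det [1/(la_i - i - mu_j + j)!] follows by
   induction from the removal of the largest entry: with xi_i = la_i - i and
   eta_j = mu_j - j, scaling the entries of row i by xi_i - eta_j lowers la_i
   by one, and the resulting determinants add up to (sum xi - sum eta) det.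

   With xi shifted to be nonnegative and xi_i! factored out of row i, the
   columns are falling factorials in xi.  Their first n+d-1 degrees are
   consecutive, so by Vandermonde's convolution they may be shifted to make the
   first d rows block triangular.  In the remaining block, taking n-1
   differences along the rows removes the polynomial columns; rescaling the
   rows turns all but two of the other columns into a basis of polynomials of
   degree below a-1, and a-1 further differences leave a 2x2 determinant, which
   is the quartic factor.  For n = 0 the special column lies in the first
   block, and the evaluation is simpler. *)

Require Import Defs.
From mathcomp Require Import perm zify ring.

Set Implicit Arguments.
Unset Strict Implicit.
Unset Printing Implicit Defensive.

(** * Standard Young tableaux as linear extensions *)

Definition cell_lt (x y : nat * nat) : bool :=
  (x.1 == y.1) && (x.2 < y.2) || (x.2 == y.2) && (x.1 < y.1).

(* The list gives the cells by decreasing entry. *)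
Definition num_linext (s : seq (nat * nat)) : nat :=
  count (pairwise (fun x y => ~~ cell_lt x y)) (permutations s).

(** The lists are classified by their head, the cell with the largest entry, which has to be maximal
    in [s]. *)
Lemma num_linext_rec (s : seq (nat * nat)) : uniq s -> 0 < size s ->
  num_linext s =
  \sum_(x <- s | all (fun y => ~~ cell_lt x y) s) num_linext (rem x s).
Proof.
move=> us s0; rewrite /num_linext.
have /seq.permP -> := permutationsE s0.
rewrite count_flatten -map_comp undup_id // sumnE big_map [RHS]big_mkcond.
apply: eq_big_seq => x xs /=; rewrite count_map.
have -> : all (fun y => ~~ cell_lt x y) s = all (fun y => ~~ cell_lt x y) (rem x s).
  rewrite (perm_all _ (perm_to_rem xs)) /= /cell_lt; lia.
have [al | al] := ifPn.
  apply: eq_in_count => t; rewrite mem_permutations => pt /=.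
  by rewrite (perm_all _ pt) al.
rewrite -[RHS](count_pred0 (permutations (rem x s))).
apply: eq_in_count => t; rewrite mem_permutations => pt /=.
by rewrite (perm_all _ pt) (negbTE al).
Qed.

Section SYTLinext.

Variable S : {fset nat * nat}.
Local Notation m := #|` S|.

(** Extends a filling to all pairs of numbers, so that it can serve as a sorting key. *)
Definition entry (T : {ffun S -> 'I_m}) (x : nat * nat) : nat :=
  if insub x is Some u then val (T u) else 0.

Definition linext_of (T : {ffun S -> 'I_m}) : seq (nat * nat) :=
  sort (fun x y => entry T y <= entry T x) (enum_fset S).

Lemma entryE (T : {ffun S -> 'I_m}) (x : S) : entry T (val x) = T x.
Proof. by rewrite /entry valK. Qed.

Lemma SYT_inj (T : {ffun S -> 'I_m}) : is_SYT T -> injective T.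
Proof.
case/and3P => /forallP h _ _ x y eT.
have /card1P [z hz] := h (T x).
have := hz x; have := hz y; rewrite !inE eT eqxx => /esym/eqP -> /esym/eqP ->.
by [].
Qed.

Lemma perm_linext_of T : perm_eq (linext_of T) (enum_fset S).
Proof. by rewrite perm_sort. Qed.

Lemma linext_of_sorted T :
  sorted (fun x y => entry T y <= entry T x) (linext_of T).
Proof. by apply: sort_sorted => x y; exact: leq_total. Qed.

(** The [m] entries are distinct and below [m], hence they are all of [0, ..., m - 1]. It follows
    that the sorted list of cells determines the tableau. *)
Lemma entry_linext_of T : is_SYT T -> map (entry T) (linext_of T) = rev (iota 0 m).
Proof.
move=> sT.
have geT : transitive geq by move=> x y z /= h1 h2; lia.
apply: (@sorted_eq _ geq) => //.
- by move=> x y /= h; lia.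
- by rewrite sorted_map; exact: linext_of_sorted.
- rewrite -[X in sorted X]/(fun x y => leq y x) rev_sorted.
  exact: iota_sorted.
have pm : perm_eq (map (entry T) (linext_of T)) (map (entry T) (enum_fset S)).
  exact/perm_map/perm_linext_of.
apply: (perm_trans pm); rewrite perm_sym perm_rev perm_sym.
have um : uniq (map (entry T) (enum_fset S)).
  rewrite map_inj_in_uniq ?fset_uniq // => x y xS yS.
  rewrite -[x]/(val [` xS]%fset) -[y]/(val [` yS]%fset) !entryE => /val_inj.
  by move/(SYT_inj sT) => ->.
apply: uniq_perm => //; first exact: iota_uniq.
have sub : {subset map (entry T) (enum_fset S) <= iota 0 m}.
  move=> k /mapP [x xS ->].
  by rewrite -[x]/(val [` xS]%fset) entryE mem_iota ltn_ord.
by have [] := uniq_min_size um sub; rewrite ?size_iota ?size_map.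
Qed.

Lemma linext_of_inj : {in [pred T | is_SYT T] &, injective linext_of}.
Proof.
move=> T T' sT sT' eL; have := entry_linext_of sT.
rewrite -(entry_linext_of sT') eL => /eq_in_map h.
apply/ffunP => x; apply: val_inj; rewrite /= -!entryE; apply: h.
by rewrite (perm_mem (perm_linext_of T')) (valP x).
Qed.

Lemma linext_ofP T : is_SYT T ->
  pairwise (fun x y => ~~ cell_lt x y) (linext_of T).
Proof.
move=> /and3P [_ /forallP hr /forallP hc]; have := linext_of_sorted T.
rewrite sorted_pairwise; last by move=> x y z h1 h2; lia.
apply: (@sub_in_pairwise _ (mem S)); last first.
  by apply/allP => x; rewrite (perm_mem (perm_linext_of T)).
move=> x y xS yS; rewrite -[x]/(val [` xS]%fset) -[y]/(val [` yS]%fset) !entryE.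
have /forallP /(_ [` yS]%fset) := hr [` xS]%fset.
have /forallP /(_ [` yS]%fset) := hc [` xS]%fset.
rewrite /cell_lt /=; lia.
Qed.

(** The tableau gives the cell at position [k] of [s] the value [m.-1 - k]. *)
Lemma linext_of_surj s : perm_eq s (enum_fset S) ->
  pairwise (fun x y => ~~ cell_lt x y) s -> exists2 T, is_SYT T & linext_of T = s.
Proof.
move=> ps pw.
have szs : size s = m by rewrite (perm_size ps).
have us : uniq s by rewrite (perm_uniq ps) fset_uniq.
have xs (x : S) : val x \in s by rewrite (perm_mem ps) (valP x).
have [ix ixE] : exists ix : S -> nat, forall x, ix x = index (val x) s.
  by exists (fun x => index (val x) s).
have ix_m x : ix x < m by rewrite ixE -szs index_mem.
have ixK x : nth (0, 0) s (ix x) = val x by rewrite ixE nth_index.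
have ix_inj : injective ix.
  by move=> x y h; apply: val_inj; rewrite -!ixK h.
have lt_m (x : S) : m.-1 - ix x < m by have := ix_m x; lia.
pose T : {ffun S -> 'I_m} := [ffun x => Ordinal (lt_m x)].
have TE x : T x = m.-1 - ix x :> nat by rewrite ffunE.
have Tinj : injective T.
  move=> x y /(congr1 (@nat_of_ord _)); rewrite !TE => h.
  by apply: ix_inj; have := ix_m x; have := ix_m y; lia.
have cell_ltT (x y : S) : cell_lt (val x) (val y) -> T x < T y.
  move=> h; rewrite !TE; have h1 := ix_m x; have h2 := ix_m y.
  case: (ltngtP (ix x) (ix y)) => h3; last 2 first.
  - lia.
  - by move: h; rewrite (ix_inj _ _ h3) /cell_lt; lia.
  have /(pairwiseP (0, 0)) /(_ (ix x) (ix y)) := pw.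
  by rewrite !inE szs h1 h2 !ixK h => /(_ isT isT h3).
exists T.
  apply/and3P; split.
  - apply/forallP => k.
    have [g gK Kg] : bijective T.
      by apply: inj_card_bij => //; rewrite card_ord cardfE.
    apply/card1P; exists (g k) => x; rewrite !inE.
    by apply/eqP/eqP => [<- | ->].
  - apply/forallP => x; apply/forallP => y; apply/implyP => h.
    by apply: cell_ltT; rewrite /cell_lt h.
  - apply/forallP => x; apply/forallP => y; apply/implyP => h.
    by apply: cell_ltT; rewrite /cell_lt h orbT.
have ent (x : S) : entry T (val x) = m.-1 - ix x by rewrite entryE TE.
have inS x : x \in s -> x \in S by rewrite (perm_mem ps).
apply/esym/(@sorted_eq_in _ (fun x y => entry T y <= entry T x)).
- by move=> x y z _ _ _ h1 h2; lia.
- move=> x y /inS xi /inS yi /=.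
  rewrite -[x]/(val [` xi]%fset) -[y]/(val [` yi]%fset) !ent => h.
  congr val; apply: ix_inj.
  by have := ix_m [` xi]%fset; have := ix_m [` yi]%fset; lia.
- rewrite sorted_pairwise; last by move=> x y z h1 h2; lia.
  apply/(pairwiseP (0, 0)) => i j; rewrite !inE => hi hj ij.
  have ii := inS _ (mem_nth (0, 0) hi); have jj := inS _ (mem_nth (0, 0) hj).
  have := ent [` ii]%fset; have := ent [` jj]%fset; rewrite !ixE /=.
  by rewrite !index_uniq // => -> ->; lia.
- exact: linext_of_sorted.
- by rewrite perm_sym perm_sort perm_sym.
Qed.

Lemma num_SYT_linext : num_SYT S = num_linext (enum_fset S).
Proof.
rewrite /num_SYT /num_linext cardE -size_filter.
set A := enum _; rewrite -(size_map linext_of).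
apply: perm_size; apply: uniq_perm.
- rewrite map_inj_in_uniq ?enum_uniq // => T T'; rewrite !mem_enum !inE.
  exact: linext_of_inj.
- exact/filter_uniq/permutations_uniq.
move=> s; rewrite mem_filter mem_permutations.
apply/mapP/andP => [[T] | [pw ps]].
  rewrite mem_enum inE => sT ->; split; first exact: linext_ofP.
  exact: perm_linext_of.
have [T sT <-] := linext_of_surj ps pw.
by exists T => //; rewrite mem_enum inE.
Qed.

End SYTLinext.

Import GRing.Theory Num.Theory.
Local Open Scope ring_scope.

(** * Aitken's determinant for skew shapes *)

Definition rfact (x e : nat) : rat := if (e <= x)%N then ((x - e)`!)%:R^-1 else 0.

Lemma fact_neq0 (n : nat) : (n`!)%:R != 0 :> rat.
Proof. by rewrite pnatr_eq0 -lt0n fact_gt0. Qed.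

(** Reading the reciprocal factorial of a negative integer as 0 is what makes this hold for every
    [e]; at [e = x.+1] the linear factor vanishes. *)
Lemma rfact_pred (x e : nat) : (x.+1%:R - e%:R) * rfact x.+1 e = rfact x e.
Proof.
rewrite /rfact; case: (ltngtP e x.+1) => h.
- rewrite -ltnS h -natrB 1?ltnW // subSn // factS natrM.
  by rewrite invfM mulVKf ?pnatr_eq0.
- by rewrite mulr0 leqNgt ltnW.
- by rewrite h ltnn subrr mul0r.
Qed.

(** In the Leibniz expansion the term of a permutation [s] acquires in total the factor
    [\sum_i (x i - y (s i))], which does not depend on [s]. *)
Lemma sum_det_row_scaled (R : comNzRingType) (N : nat) (x y : 'I_N -> R) (A : 'M[R]_N) :
  \sum_r \det (\matrix_(i, j) (if i == r then (x i - y j) * A i j else A i j))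
  = (\sum_i x i - \sum_j y j) * \det A.
Proof.
rewrite /determinant exchange_big mulr_sumr; apply: eq_bigr => s _.
rewrite -mulr_sumr mulrCA; congr (_ * _).
have -> : \sum_i x i - \sum_j y j = \sum_i (x i - y (s i)).
  rewrite sumrB; congr (_ - _).
  by rewrite (reindex_inj (@perm_inj _ s)).
rewrite mulr_suml; apply: eq_bigr => r _.
rewrite (bigD1 r) //= [in RHS](bigD1 r) //= mulrA mxE eqxx; congr (_ * _).
by apply: eq_bigr => i /negbTE ir; rewrite mxE ir.
Qed.

(** The first [r + 1] rows live in only [r] columns, so by the pigeonhole principle every Leibniz
    term contains a zero. *)
Lemma det_zero_block (R : comNzRingType) (N r : nat) (A : 'M[R]_N) : (r < N)%N ->
  (forall i j : 'I_N, (i <= r)%N -> (r <= j)%N -> A i j = 0) -> \det A = 0.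
Proof.
move=> rN hA; rewrite /determinant big1 // => s _.
have [/existsP [i /andP [ir rs]] | ] := boolP [exists i : 'I_N, (i <= r)%N && (r <= s i)%N].
  by rewrite (bigD1 i) //= hA // mul0r mulr0.
rewrite negb_exists => /forallP h.
have hs (i : 'I_r.+1) : (s (widen_ord rN i) < r)%N.
  by have := h (widen_ord rN i); have := ltn_ord i; rewrite /=; lia.
pose f i : 'I_r := Ordinal (hs i).
have /leq_card : injective f.
  move=> i j /(congr1 val) /= e; have /perm_inj := val_inj e.
  by move=> /(congr1 val) /= /val_inj.
by rewrite !card_ord ltnn.
Qed.

(* Rows are numbered from the bottom, so that the beta-sets [la i + i] and
   [mu j + j] are increasing. *)
Definition aitken_mx (N : nat) (la mu : nat -> nat) : 'M[rat]_N :=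
  \matrix_(i < N, j < N) rfact (la i + i) (mu j + j).

Section Aitken.

Variables (N : nat) (mu : nat -> nat).
Hypothesis mu_mono : forall i j, (i <= j)%N -> (j < N)%N -> (mu i <= mu j)%N.

(** Cells number the rows from the top starting at 1, whereas [la] and [mu] number them from the
    bottom starting at 0; this is the passage from [p.1] to [N - p.1]. *)
Definition is_skew (la : nat -> nat) (s : seq (nat * nat)) : Prop :=
  forall p, (p \in s) =
    [&& 0 < p.1, p.1 <= N, mu (N - p.1) < p.2 & p.2 <= la (N - p.1)]%N.

Definition drop_cell (la : nat -> nat) (r i : nat) : nat :=
  if i == r then (la i).-1 else la i.

Definition removable (la : nat -> nat) (r : nat) : bool :=
  (mu r < la r)%N && ((r == 0%N) || (la r.-1 < la r)%N).

Lemma size_skew la s : uniq s -> is_skew la s ->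
  size s = (\sum_(i < N) (la i - mu i))%N.
Proof.
move=> us hs.
have ps : perm_eq s [seq ((N - r)%N, j) | r <- iota 0 N, j <- iota (mu r).+1 (la r - mu r)].
  apply: uniq_perm => //.
    apply: allpairs_uniq_dep => [|r _|]; try exact: iota_uniq.
    move=> [r j] [r' j'] /allpairsPdep [x [y [xi _ ->]]] /allpairsPdep [x' [y' [xi' _ ->]]].
    rewrite !mem_iota in xi xi' => /= -[e1 ->].
    by have -> : x = x' by lia.
  move=> [p q]; rewrite hs /=; apply/idP/allpairsPdep => [h | [r [j [h1 h2 [-> ->]]]]].
    exists (N - p)%N, q; rewrite !mem_iota; split; [lia | lia |].
    by congr (_, _); lia.
  move: h1 h2; rewrite !mem_iota => h1 h2.
  have -> : (N - (N - r) = r)%N by lia.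
  lia.
rewrite (perm_size ps) size_allpairs_dep sumnE big_map -[N in iota 0 N]subn0.
rewrite -/(index_iota 0 N) big_mkord; apply: eq_bigr => i _.
by rewrite size_iota.
Qed.

(** The maximal cells of a skew shape are the ends of the nonempty rows that are longer than the row
    below. *)
Lemma num_linext_skew la s :
  (forall i j, (i <= j)%N -> (j < N)%N -> (la i <= la j)%N) ->
  uniq s -> is_skew la s -> (0 < size s)%N ->
  num_linext s =
  (\sum_(r < N | removable la r) num_linext (rem ((N - r)%N, la r) s))%N.
Proof.
move=> hla us hs s0; rewrite num_linext_rec // -big_filter.
rewrite (perm_big [seq ((N - r)%N, la r) | r <- [seq r <- iota 0 N | removable la r]]) /=.
  rewrite big_map big_filter -[N in iota 0 N]subn0 -/(index_iota 0 N).
  by rewrite big_mkord.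
apply: uniq_perm; first exact: filter_uniq.
  rewrite map_inj_in_uniq ?filter_uniq ?iota_uniq // => i j.
  by rewrite !mem_filter !mem_iota => hi hj [e _]; lia.
move=> [p q]; rewrite mem_filter hs /=; apply/idP/mapP.
  case/andP => /allP h /and4P [p0 pN mq ql]; exists (N - p)%N; last first.
    congr (_, _); first lia.
    apply/eqP; rewrite eqn_leq ql leqNgt; apply/negP => lt.
    have /= := h (p, la (N - p)%N); rewrite hs /cell_lt /= p0 pN leqnn eqxx lt.
    by rewrite (leq_trans mq ql) => /(_ isT).
  rewrite mem_filter mem_iota; apply/andP; split; last by lia.
  rewrite /removable (leq_trans mq ql) /=.
  have [-> //| Np] := eqVneq (N - p)%N 0%N.
  rewrite /= ltnNge; apply/negP => le.
  (* Otherwise the cell directly below [(p, q)] would belong to the shape, because [mu] is no larger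
     in that row. *)
  have /= := h (p.+1, q).
  have e : (N - p.+1 = (N - p).-1)%N by lia.
  have mu1 : (mu (N - p).-1 <= mu (N - p))%N by apply: mu_mono; lia.
  rewrite hs /cell_lt /= e (leq_ltn_trans mu1 mq) (leq_trans ql le).
  rewrite eqxx ltnSn orbT; have -> : (p < N)%N by lia.
  by move/(_ isT).
case=> r; rewrite mem_filter mem_iota /removable => hr [-> ->].
have e : (N - (N - r) = r)%N by lia.
rewrite e; apply/andP; split; last by lia.
apply/allP => -[p' q']; rewrite hs /cell_lt /=.
case: (ltngtP p' (N - r)%N) => h; case: (ltngtP q' (la r)) => h' //=.
- have : (la (N - p') <= la r.-1)%N by apply: hla; lia.
  lia.
- by rewrite h e; lia.
Qed.

Lemma det_row_scaled_removable (la : nat -> nat) (r : 'I_N) : (0 < la r)%N ->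
  \matrix_(i, j) (if i == r then ((la i + i)%:R - (mu j + j)%:R) * aitken_mx N la mu i j
                  else aitken_mx N la mu i j) = aitken_mx N (drop_cell la r) mu.
Proof.
move=> la0; apply/matrixP => i j; rewrite !mxE /drop_cell.
have [-> | ne] := eqVneq i r.
  rewrite eqxx -[in RHS]rfact_pred.
  by have -> : ((la r).-1 + r).+1 = (la r + r)%N by lia.
by rewrite [(i : nat) == r](negbTE ne).
Qed.

(** If row [r] is empty, the scaled matrix vanishes in rows up to [r] and columns from [r] on; where
    the beta-numbers coincide, the scaling factor is 0. If the row below is equally long, lowering
    [la r] by one makes two rows of the matrix equal. *)
Lemma det_row_scaled_nonremovable (la : nat -> nat) (r : 'I_N) :
  (forall i j, (i <= j)%N -> (j < N)%N -> (la i <= la j)%N) ->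
  (forall i, (i < N)%N -> (mu i <= la i)%N) -> ~~ removable la r ->
  \det (\matrix_(i, j)
     (if i == r then ((la i + i)%:R - (mu j + j)%:R) * aitken_mx N la mu i j
      else aitken_mx N la mu i j)) = 0.
Proof.
move=> hla mula; have [lt | ge] := ltnP (mu r) (la r); last first.
  have e : la r = mu r by apply/eqP; rewrite eqn_leq ge mula.
  move=> _; apply: (det_zero_block (ltn_ord r)) => i j ir rj; rewrite !mxE.
  have hmu : (mu r <= mu j)%N by apply: mu_mono.
  have hl : (la i <= la r)%N by apply: hla.
  have [-> | ne] := eqVneq i r.
    rewrite /rfact; case: leqP => h; last by rewrite mulr0.
    by rewrite (_ : (mu j + j) = (la r + r))%N ?subrr ?mul0r //; lia.
  have {}ne : (i : nat) != r by [].
  by rewrite /rfact leqNgt (_ : (_ < _)%N) //; lia.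
rewrite /removable lt /= negb_or -leqNgt => /andP [r0 le].
have r1N : (r.-1 < N)%N by have := ltn_ord r; lia.
have la1 : (la r.-1 <= la r)%N by apply: hla; rewrite ?leq_pred.
rewrite det_row_scaled_removable; last by lia.
apply: (determinant_alternate (i1 := Ordinal r1N) (i2 := r)).
  by rewrite -val_eqE /=; lia.
move=> j; rewrite !mxE /drop_cell /= eqxx.
have -> : (r.-1 == r :> nat) = false by lia.
by congr rfact; lia.
Qed.

Lemma aitken (la : nat -> nat) s :
  (forall i j, (i <= j)%N -> (j < N)%N -> (la i <= la j)%N) ->
  (forall i, (i < N)%N -> (mu i <= la i)%N) -> uniq s -> is_skew la s ->
  (num_linext s)%:R = ((size s)`!)%:R * \det (aitken_mx N la mu).
Proof.
move sz: (size s) => k; elim: k la s sz => [|k IH] la s sz hla mula us hs.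
  have -> : s = [::] by apply: size0nil.
  have e (i : 'I_N) : la i = mu i.
    apply/eqP; rewrite eqn_leq mula // andbT leqNgt; apply/negP => h.
    have := hs ((N - i)%N, la i); rewrite (size0nil sz) in_nil /=.
    have iN := ltn_ord i.
    have -> : (N - (N - i) = i)%N by lia.
    by rewrite h leqnn; lia.
  (* The shape is empty, so [la = mu] and the matrix is triangular with ones on the diagonal. *)
  rewrite det_trig.
    rewrite big1 ?mulr1 // => i _.
    by rewrite mxE e /rfact leqnn subnn fact0 invr1.
  apply/is_trig_mxP => i j ij; rewrite mxE e /rfact leqNgt.
  have := mu_mono (ltnW ij) (ltn_ord j).
  by case: ltnP => //; lia.
rewrite (num_linext_skew hla us hs) ?sz // natr_sum factS natrM.
(* The number of cells is the difference of the sums of the two beta-sets, which is the factor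
   produced by [sum_det_row_scaled]. *)
have -> : k.+1%:R = \sum_(i < N) (la i + i)%:R - \sum_(j < N) (mu j + j)%:R :> rat.
  rewrite -sz (size_skew us hs) -sumrB natr_sum; apply: eq_bigr => i _.
  by rewrite natrB ?mula // !natrD; ring.
rewrite -mulrA mulrCA -sum_det_row_scaled mulr_sumr [LHS]big_mkcond.
apply: eq_bigr => r _; have [rr | nr] := ifPn; last first.
  by rewrite det_row_scaled_nonremovable // mulr0.
move: (rr); rewrite /removable => hr.
have rN := ltn_ord r.
rewrite det_row_scaled_removable; last by lia.
have ms : ((N - r)%N, la r) \in s.
  rewrite hs /=; have -> : (N - (N - r) = r)%N by lia.
  lia.
apply: IH => [| i j ij jN | i iN | | p].
- by rewrite size_rem // sz.
- rewrite /drop_cell; have h := hla _ _ ij jN; case: eqP => ei; case: eqP => ej //; try lia.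
  have : (la i <= la r.-1)%N by apply: hla; lia.
  by rewrite ej in ij h *; lia.
- by rewrite /drop_cell; have := mula _ iN; case: eqP => [->|]; lia.
- exact: rem_uniq.
rewrite mem_rem_uniq // inE hs /drop_cell; case: p => p q /=; rewrite xpair_eqE.
case: (eqVneq (N - p)%N r) => [e | ne].
  rewrite e; case: (ltngtP q (la r)) => h; [|lia|]; rewrite ?andbF ?andbT /=; lia.
have -> : (p == N - r)%N = false by lia.
lia.
Qed.

End Aitken.

(** * Determinants given by columns, and row differences *)

(* [F j i] is the entry in column [j] and row [i]. *)
Definition Dt (N : nat) (F : nat -> nat -> rat) : rat :=
  \det (\matrix_(i < N, j < N) F j i).

Definition Delta (f : nat -> rat) (i : nat) : rat := f i.+1 - f i.

Lemma eq_Dt N (F G : nat -> nat -> rat) :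
  (forall j i, (j < N)%N -> (i < N)%N -> F j i = G j i) -> Dt N F = Dt N G.
Proof. by move=> h; congr determinant; apply/matrixP => i j; rewrite !mxE h. Qed.

Lemma Dt_scale N (u v : nat -> rat) F :
  Dt N (fun j i => u i * v j * F j i)
  = (\prod_(i < N) u i) * (\prod_(j < N) v j) * Dt N F.
Proof.
rewrite /Dt /determinant mulr_sumr; apply: eq_bigr => s _.
rewrite mulrCA; congr (_ * _).
rewrite (reindex_inj (@perm_inj _ s) (P := xpredT) (F := fun j : 'I_N => v j)) /=.
by rewrite -!big_split /=; apply: eq_bigr => i _; rewrite !mxE.
Qed.

(** The column operations amount to multiplication on the right by an upper unitriangular matrix.
    The offset [p] protects the leading columns. *)
Lemma Dt_colops p N (F G : nat -> nat -> rat) :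
  (forall j i, (j < p)%N -> (j < N)%N -> (i < N)%N -> G j i = F j i) ->
  (forall j, (p + j < N)%N -> exists c : nat -> rat, forall i, (i < N)%N ->
     G (p + j)%N i = F (p + j)%N i + \sum_(l < j) c l * F (p + l)%N i) ->
  Dt N G = Dt N F.
Proof.
move=> hp hG.
have h (j : 'I_N) : exists c : nat -> rat, forall i, (i < N)%N ->
    G j i = F j i + \sum_(l < N | (l < j)%N) c l * F l i.
  have [jp | pj] := ltnP j p.
    by exists (fun => 0) => i iN; rewrite hp // big1 ?addr0 // => l _; rewrite mul0r.
  have [|c hc] := hG (j - p)%N; first by rewrite subnKC.
  exists (fun l => if (l < p)%N then 0 else c (l - p)%N) => i iN.
  rewrite -[in LHS](subnKC pj) hc // subnKC //; congr (_ + _).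
  rewrite -(big_mkord xpredT (fun l => c l * F (p + l)%N i)).
  rewrite -(big_mkord (fun l => (l < j)%N)
    (fun l => (if (l < p)%N then 0 else c (l - p)%N) * F l i)).
  rewrite -[RHS](big_nat_widen 0%N j N xpredT); last exact: ltnW.
  rewrite [RHS](big_cat_nat (n := p)) //= [X in _ = X + _]big_nat_cond.
  rewrite [X in _ = X + _]big1 ?add0r; last by move=> l /andP [/andP [_ ->] _]; rewrite mul0r.
  rewrite -[X in index_iota X j]add0n big_addn; apply: eq_big_nat => l _.
  by rewrite addnK ltnNge leq_addl addnC.
have [c hc] := fin_all_exists h.
pose U : 'M[rat]_N := \matrix_(l, j) (if (l < j)%N then c j l else (l == j)%:R).
have -> : Dt N G = \det ((\matrix_(i < N, j < N) F j i) *m U).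
  congr determinant; apply/matrixP => i j; rewrite !mxE hc //.
  under [RHS]eq_bigr do rewrite !mxE.
  rewrite [RHS](bigID (fun l : 'I_N => (l < j)%N)) /= [RHS]addrC; congr (_ + _); last first.
    by apply: eq_bigr => l ->; rewrite mulrC.
  rewrite (bigD1 j) ?ltnn //= eqxx mulr1 big1 ?addr0 // => l /andP [/negbTE -> ].
  by move=> /negbTE ->; rewrite mulr0.
rewrite det_mulmx; suff -> : \det U = 1 by rewrite mulr1.
rewrite -det_tr det_trig.
  by rewrite big1 // => i _; rewrite !mxE ltnn eqxx.
apply/is_trig_mxP => i j ij; rewrite !mxE ltnNge (ltnW ij) /=.
by case: eqP => // e; rewrite e ltnn in ij.
Qed.

Lemma Dt_block p q (F : nat -> nat -> rat) :
  (forall j i, (i < p)%N -> (p <= j < p + q)%N -> F j i = 0) ->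
  Dt (p + q) F = Dt p F * Dt q (fun j i => F (p + j)%N (p + i)%N).
Proof.
move=> h; rewrite {1}/Dt -[X in \det X]submxK.
have -> : ursubmx (\matrix_(i < p + q, j < p + q) F j i) = 0.
  by apply/matrixP => i j; rewrite !mxE h //= leq_addr ltn_add2l ltn_ord.
rewrite det_lblock; congr (_ * _); congr determinant.
  by apply/matrixP => i j; rewrite !mxE.
by apply/matrixP => i j; rewrite !mxE.
Qed.

Lemma Dt_trig N (F : nat -> nat -> rat) :
  (forall j i, (i < j)%N -> (j < N)%N -> F j i = 0) ->
  Dt N F = \prod_(i < N) F i i.
Proof.
move=> h; rewrite /Dt det_trig; first by apply: eq_bigr => i _; rewrite mxE.
by apply/is_trig_mxP => i j ij; rewrite mxE h.
Qed.

(** Subtracting from each row its predecessor turns the column of ones into a unit vector, along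
    which the determinant is expanded. *)
Lemma Dt_delta N (F : nat -> nat -> rat) :
  (forall i, (i < N.+1)%N -> F 0%N i = 1) ->
  Dt N.+1 F = Dt N (fun j => Delta (F j.+1)).
Proof.
move=> F0.
pose L : 'M[rat]_N.+1 := \matrix_(i, k) ((i == k)%:R - (i == k.+1 :> nat)%:R).
pose B : 'M[rat]_N.+1 :=
  \matrix_(i, j) (if (i : nat) is i'.+1 then Delta (F j) i' else F j 0%N).
have LB : L *m (\matrix_(i < N.+1, j < N.+1) F j i) = B.
  apply/matrixP => i j; rewrite !mxE.
  under eq_bigr do rewrite !mxE mulrBl.
  rewrite sumrB (bigD1 i) //= eqxx mul1r big1 ?addr0; last first.
    by move=> k ki; rewrite eq_sym (negbTE ki) mul0r.
  case: i => [[|i] iN] /=.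
    by rewrite big1 ?subr0 // => k _; rewrite mul0r.
  rewrite /Delta; congr (_ - _).
  have iN' : (i < N.+1)%N by rewrite ltnW.
  rewrite (bigD1 (Ordinal iN')) //= eqxx mul1r big1 ?addr0 // => k.
  by rewrite -val_eqE eqSS /= eq_sym => /negbTE ->; rewrite mul0r.
have detL : \det L = 1.
  rewrite det_trig; first by rewrite big1 // => i _; rewrite mxE eqxx (ltn_eqF (ltnSn _)) subr0.
  apply/is_trig_mxP => i j ij; rewrite mxE -val_eqE /=.
  by rewrite (ltn_eqF ij) (ltn_eqF (ltnW ij : (i < j.+1)%N)) subr0.
rewrite /Dt -[LHS]mul1r -detL -det_mulmx LB (expand_det_col _ ord0).
rewrite big_ord_recl big1 ?addr0 => [|i _].
  rewrite mxE F0 // mul1r /cofactor addn0 expr0 mul1r; congr determinant.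
  by apply/matrixP => i j; rewrite !mxE.
rewrite mxE lift0 /Delta F0; last by rewrite ltnS.
by rewrite F0 ?subrr ?mul0r // ltnW // ltnS.
Qed.

Lemma Dt_swap01 N (F : nat -> nat -> rat) :
  Dt N.+2 F = - Dt N.+2 (fun j => F (if j == 0 then 1 else if j == 1 then 0 else j)%N).
Proof.
pose A := \matrix_(i < N.+2, j < N.+2) F j i.
pose j1 : 'I_N.+2 := Ordinal (isT : (1 < N.+2)%N).
have -> : Dt N.+2 (fun j => F (if j == 0 then 1 else if j == 1 then 0 else j)%N)
          = \det (xcol ord0 j1 A).
  congr determinant; apply/matrixP => i j; rewrite !mxE.
  case: tpermP => [->|->|/eqP h0 /eqP h1] //=.
  by move: h0 h1; rewrite -!val_eqE /= => /negbTE -> /negbTE ->.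
by rewrite xcolE det_mulmx det_perm odd_tperm /= expr1 mulrN1 opprK.
Qed.

Lemma iter_Delta_lin p (x y : rat) f g i :
  iter p Delta (fun i => x * f i + y * g i) i
  = x * iter p Delta f i + y * iter p Delta g i.
Proof.
elim: p i => //= p IH i.
by rewrite /Delta !IH; ring.
Qed.

Lemma eq_iter_Delta p f g : f =1 g -> iter p Delta f =1 iter p Delta g.
Proof. by move=> h; elim: p => //= p IH i; rewrite /Delta !IH. Qed.

Lemma iter_Delta_bin p y k i :
  iter p Delta (fun i => ('C(y + i, p + k))%:R) i = ('C(y + i, k))%:R.
Proof.
elim: p k i => //= p IH k i.
rewrite addSnnS /Delta !IH addnS binS natrD.
by ring.
Qed.

(** Each use of [Dt_delta] removes the constant column; by Pascal's rule the differences of the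
    remaining binomial columns have the same form with degrees one lower. *)
Lemma Dt_bin y p q (F : nat -> nat -> rat) :
  (forall j i, (j < p)%N -> F j i = ('C(y + i, j))%:R) ->
  Dt (p + q) F = Dt q (fun j => iter p Delta (F (p + j)%N)).
Proof.
elim: p F => [|p IH] F h; first by [].
rewrite addSn Dt_delta; last by move=> i _; rewrite h // bin0.
rewrite IH; first by apply: eq_Dt => j i _ _; rewrite -iterSr.
move=> j i jp; rewrite /Delta !h // -natrB; last by rewrite leq_bin2l // leq_add2l.
by rewrite addnS binS addKn.
Qed.

(** As [Dt_bin], with one further column kept in front. Each round first swaps it with the constant
    column, which costs a sign, and the differences have the same form for [y.+1]. *)
Lemma Dt_bin_swap y p q (F : nat -> nat -> rat) :
  (forall j i, (j < p)%N -> F j.+1 i = ('C(y + j + i, j))%:R) ->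
  Dt (p + q).+1 F =
  (-1) ^+ p * Dt q.+1 (fun j => iter p Delta (F (if j == 0 then 0 else p + j)%N)).
Proof.
elim: p y F => [|p IH] y F h.
  by rewrite mul1r; apply: eq_Dt => -[|j] i.
rewrite addSn Dt_swap01 Dt_delta; last by move=> i _; rewrite h // bin0.
rewrite (IH y.+1).
  rewrite exprS mulN1r mulNr; congr (- (_ * _)).
  apply: eq_Dt => -[|j] i _ _ /=; first by rewrite -iterSr.
  by rewrite -[in RHS]iterS iterSr addSn addnS.
move=> j i jp /=; rewrite /Delta !h // -natrB; last by rewrite leq_bin2l // leq_add2l.
by rewrite addnS binS addKn; do 2 f_equal; lia.
Qed.

Lemma Dt2 (F : nat -> nat -> rat) : Dt 2 F = F 0%N 0%N * F 1%N 1%N - F 1%N 0%N * F 0%N 1%N.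
Proof.
rewrite /Dt (expand_det_row _ ord0) !big_ord_recl big_ord0 /cofactor !det_mx11 !mxE /=.
by rewrite !(addn0, addn1, expr0, expr1); ring.
Qed.

Lemma Dt1 (F : nat -> nat -> rat) : Dt 1 F = F 0%N 0%N.
Proof. by rewrite /Dt det_mx11 mxE. Qed.

Lemma prod_ord_add p q (f : nat -> rat) :
  \prod_(i < p + q) f i = (\prod_(i < p) f i) * \prod_(i < q) f (p + i)%N.
Proof. by rewrite big_split_ord. Qed.

(** * Falling factorials, rising factorials and their differences *)

Lemma rfactE x e : rfact x e = (x ^_ e)%:R / (x`!)%:R.
Proof.
rewrite /rfact; case: leqP => h; last by rewrite ffact_small // mul0r.
by rewrite -(ffact_fact h) natrM invfM mulVKf // pnatr_eq0 -lt0n ffact_gt0.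
Qed.

Lemma binE r s : ('C(r + s, r))%:R = ((r + s)`!)%:R / ((r`!)%:R * (s`!)%:R) :> rat.
Proof.
have := bin_fact (leq_addr s r); rewrite addKn => <-; rewrite !natrM.
by field; rewrite !fact_neq0.
Qed.

(** Vandermonde's convolution expands ['C(e + z i, k)] in the ['C(z i, l)], and earlier columns
    clear the lower terms. Degree [q] is skipped by [eta], so in column [q], of degree [q.+1], the
    term [e * 'C(z i, q)] survives. *)
Lemma Dt_rfact_low q r e (z eta : nat -> nat) :
  (forall j, (j < q)%N -> eta j = j) -> eta q = q.+1 ->
  Dt (q.+1 + r) (fun j i => rfact (e + z i) (eta j)) =
  (\prod_(i < q.+1 + r) ((e + z i)`!)%:R)^-1 * (\prod_(j < q) (j`!)%:R) * (q.+1`!)%:R *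
  Dt (q.+1 + r) (fun j i =>
    if (j < q)%N then ('C(z i, j))%:R
    else if j == q then ('C(z i, q.+1))%:R + e%:R * ('C(z i, q))%:R
    else ((e + z i) ^_ (eta j))%:R).
Proof.
move=> eta_lt eta_q; set F := fun j i => if (j < q)%N then _ else _.
pose v j : rat := if (j <= q)%N then ((eta j)`!)%:R else 1.
pose F1 j i : rat :=
  if (j <= q)%N then ('C(e + z i, eta j))%:R else ((e + z i) ^_ (eta j))%:R.
rewrite (@eq_Dt _ _ (fun j i => ((e + z i)`!)%:R^-1 * v j * F1 j i)); last first.
  move=> j i _ _; rewrite rfactE /v /F1; case: ifP => _; last by rewrite mulr1 mulrC.
  by rewrite -mulrA -natrM mulnC bin_ffact mulrC.
rewrite Dt_scale prodfV -!mulrA; congr (_ * _); rewrite mulrA; congr (_ * _).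
  rewrite prod_ord_add [X in _ * X]big1 ?mulr1; last first.
    by move=> i _; rewrite /v leqNgt ltnS leq_addr.
  rewrite big_ord_recr /= /v leqnn eta_q; congr (_ * _).
  by apply: eq_bigr => j _; rewrite ltnW // eta_lt.
apply: (@Dt_colops 0) => // j _; rewrite !add0n.
have vdm x k : ('C(e + x, k))%:R = \sum_(l < k.+1) ('C(e, k - l))%:R * ('C(x, l))%:R :> rat.
  rewrite addnC -binomial.Vandermonde natr_sum; apply: eq_bigr => l _.
  by rewrite natrM mulrC.
have [jq | qj | ->] := ltngtP j q.
- exists (fun l => ('C(e, j - l))%:R) => i _.
  rewrite /F1 /F (ltnW jq) jq eta_lt // vdm big_ord_recr /= subnn bin0 mul1r addrC.
  congr (_ + _); apply: eq_bigr => l _.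
  by rewrite add0n (ltn_trans (ltn_ord l) jq).
- exists (fun => 0) => i _; rewrite big1 ?addr0; last by move=> l _; rewrite mul0r.
  by rewrite /F1 /F leqNgt qj /= ltnNge (ltnW qj) /= gtn_eqF.
exists (fun l => ('C(e, q.+1 - l))%:R) => i _.
rewrite /F1 /F leqnn ltnn eqxx eta_q vdm !big_ord_recr /= subnn bin0 mul1r.
rewrite subSnn bin1.
under [X in _ = _ + X]eq_bigr do rewrite add0n ltn_ord.
by ring.
Qed.

(* Coefficients of the falling factorial [t ^_ k] in the rising factorials
   [(t + h + l)! / (t + h)!], l <= k. *)
Fixpoint frc (h k l : nat) : rat :=
  if k is k'.+1 then
    (if l is l'.+1 then frc h k' l' else 0) - (h + l + k)%:R * frc h k' l
  else (l == 0%N)%:R.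

Lemma frc_gt h k l : (k < l)%N -> frc h k l = 0.
Proof.
elim: k l => [|k IH] [|l] //= kl.
by rewrite !IH ?(ltnW kl) // mulr0 subr0.
Qed.

Lemma frc_diag h k : frc h k k = 1.
Proof. by elim: k => //= k ->; rewrite frc_gt // mulr0 subr0. Qed.

(** Needed for the last column of the lower block: its degree is preceded by a missing one, so this
    term cannot be cleared. *)
Lemma frc_subdiag h k : frc h k.+1 k = - (k.+1%:R * (h + k.+1)%:R).
Proof.
elim: k => [|k IH]; first by rewrite /= addn0 mulr1 mul1r sub0r.
have -> : frc h k.+2 k.+1 = frc h k.+1 k - (h + k.+1 + k.+2)%:R * frc h k.+1 k.+1 by [].
by rewrite IH frc_diag !natrD -!natr1; ring.
Qed.

(** Writing [t - k] as [(t + h + l + 1) - (h + l + k + 1)] shows how multiplication by [t - k] acts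
    on [(t + h + l)!]; this is the recursion of [frc]. *)
Lemma ffact_rising h k t :
  (t ^_ k)%:R * ((t + h)`!)%:R = \sum_(l < k.+1) frc h k l * ((t + h + l)`!)%:R.
Proof.
elim: k => [|k IH]; first by rewrite big_ord_recr big_ord0 /= addn0 add0r.
have -> : (t ^_ k.+1)%:R = (t ^_ k)%:R * (t%:R - k%:R) :> rat.
  rewrite ffactnSr natrM; have [kt | tk] := leqP k t; first by rewrite natrB.
  by rewrite ffact_small // !mul0r.
rewrite mulrAC IH mulr_suml.
under [RHS]eq_bigr do rewrite [frc _ _ _]/= mulrBl.
rewrite sumrB [X in _ = X - _]big_ord_recl mul0r add0r.
rewrite [X in _ = _ - X]big_ord_recr /= frc_gt // mulr0 mul0r addr0 -sumrB.
apply: eq_bigr => l _; rewrite /bump add0n add1n addnS factS natrM.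
by rewrite -!natr1 !natrD -!natr1; ring.
Qed.

Arguments frc : simpl never.

Lemma fact_ratio_bin x L i :
  ((x + i + L)`!)%:R / ((x + i)`!)%:R = (L`!)%:R * ('C(x + L + i, L))%:R :> rat.
Proof.
have -> : (x + L + i = L + (x + i))%N by lia.
by rewrite binE addnC; field; rewrite !fact_neq0.
Qed.

Lemma iter_Delta_fact_ratio p r x i :
  iter p Delta (fun i => ((x + i + (p + r))`!)%:R / ((x + i)`!)%:R) i =
  ((p + r)`!)%:R / (r`!)%:R * (((x + i + (p + r))`!)%:R / ((x + i + p)`!)%:R).
Proof.
(* The ratio is a multiple of a binomial coefficient; the zero summand brings it into the form of
   [iter_Delta_lin]. *)
rewrite (@eq_iter_Delta p _ (fun i => ((p + r)`!)%:R * ('C(x + (p + r) + i, p + r))%:R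
   + 0 * ('C(x + (p + r) + i, p + r))%:R)); last first.
  by move=> j; rewrite fact_ratio_bin mul0r addr0.
rewrite iter_Delta_lin mul0r addr0 iter_Delta_bin.
have -> : (x + (p + r) + i = r + (x + i + p))%N by lia.
rewrite binE; have -> : (x + i + (p + r) = r + (x + i + p))%N by lia.
by field; rewrite !fact_neq0.
Qed.

(** The Pochhammer symbol. *)
Definition rfac (c k : nat) : rat := \prod_(p < k) (c + p)%:R.

(** One difference reproduces the function with [c + 1] in place of [c], times [- c]. Iteration
    accumulates the rising factorial of [c] and the sign. *)
Lemma iter_Delta_special (n q c p x i : nat) :
  iter p Delta (fun i => (n * (x + i).+1 + q * c)%:R * ((x + i)`!)%:R
                         / ((x + i + c).+1`!)%:R) i =
  (-1) ^+ p * rfac c p * (n * (x + i).+1 + q * (c + p))%:R * ((x + i)`!)%:R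
  / ((x + i + c + p).+1`!)%:R.
Proof.
elim: p i => [|p IH] i.
  by rewrite /rfac big_ord0 expr0 !mul1r !addn0.
rewrite iterS {1}/Delta !IH /rfac big_ord_recr /= exprS.
have -> : (x + i.+1 + c + p).+1 = (x + i + c + p).+2 by lia.
rewrite !addnS [((x + i).+1)`!]factS ![((x + i + c + p).+2)`!]factS.
set A := \prod_(_ < _) _; set s := (-1) ^+ p.
move: (fact_neq0 (x + i + c + p).+1).
move: ((x + i + c + p).+1`!) ((x + i)`!) => f g h1.
have h2 : (x + i + c + p).+2%:R != 0 :> rat by rewrite pnatr_eq0.
move: h2; rewrite !(natrD, natrM, =^~ natr1) => h2.
by field; rewrite h1.
Qed.

Lemma rfact_shift s t k : rfact (s + t) (s + k) = rfact t k.
Proof. by rewrite /rfact leq_add2l subnDl. Qed.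

Lemma ffactE x k : (x ^_ k)%:R = (x`!)%:R * rfact x k.
Proof. by rewrite rfactE; field; rewrite fact_neq0. Qed.

Lemma bin_rfact x k : ('C(x, k))%:R = (x`!)%:R / (k`!)%:R * rfact x k.
Proof.
by rewrite mulrAC -ffactE -bin_ffact natrM mulfK // fact_neq0.
Qed.

Lemma natr_factS k : (k.+1`!)%:R = k.+1%:R * (k`!)%:R :> rat.
Proof. by rewrite factS natrM. Qed.

(** * The lower block: from falling to rising factorials *)

Section LowerBlock.

Variables n' a' b c d : nat.
Local Notation n := n'.+1.
Local Notation a := a'.+1.
Local Notation e := (n + c)%N.
Local Notation m := (b + d)%N.

(** Degree [a'] is skipped because the first part of [mu] is [c + 1] instead of [c]. *)
Definition gap (k : nat) : nat := if (k < a')%N then k else k.+1.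

Definition low_col (j i : nat) : rat :=
  if (j < n')%N then ('C(b + i, j))%:R
  else n%:R * ('C(b + i, n))%:R + (e * (n + d))%:R * ('C(b + i, n'))%:R.

Definition lower_mx (j i : nat) : rat :=
  if (j < n')%N then ('C(m + i, d + j))%:R
  else if j == n' then ('C(m + i, d + n))%:R + e%:R * ('C(m + i, d + n'))%:R
  else ((e + (m + i)) ^_ (e + d + gap (j - n)))%:R.

Definition falling_mx (j i : nat) : rat :=
  if (j <= n')%N then low_col j i
  else ((m + i + e)`!)%:R / ((m + i)`!)%:R * ((b + i) ^_ (gap (j - n)))%:R.

Definition rising_mx (j i : nat) : rat :=
  if (j <= n')%N then low_col j i
  else if (j - n < a')%N then ((m + i + (e + (j - n)))`!)%:R / ((m + i)`!)%:R
  else 1 * (((m + i + (e + a))`!)%:R / ((m + i)`!)%:R) + 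
       (- (a%:R * (d + e + a)%:R)) * (((m + i + (e + a'))`!)%:R / ((m + i)`!)%:R).

Definition upper_factor (j : nat) : rat :=
  if (j < n')%N then (j`!)%:R / ((d + j)`!)%:R
  else if j == n' then (n'`!)%:R / ((d + n)`!)%:R else 1.

(** Since [m + i = d + (b + i)], a common shift of both arguments of [rfact] turns every entry into
    a row factor times a falling factorial or binomial of [b + i]. The first [n'] columns thereby
    take the form required by [Dt_bin]. *)
Lemma Dt_lower_falling :
  Dt (n' + a'.+2) lower_mx =
  (\prod_(i < n' + a'.+2) (((m + i)`!)%:R / ((b + i)`!)%:R))
  * ((\prod_(j < n') ((j`!)%:R / ((d + j)`!)%:R)) * ((n'`!)%:R / ((d + n)`!)%:R))
  * Dt (n' + a'.+2) falling_mx.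
Proof.
have -> : (\prod_(j < n') ((j`!)%:R / ((d + j)`!)%:R)) * ((n'`!)%:R / ((d + n)`!)%:R)
    = \prod_(j < n' + a'.+2) upper_factor j.
  rewrite prod_ord_add big_ord_recl /upper_factor addn0 ltnn eqxx.
  rewrite [X in _ = _ * (_ * X)]big1 ?mulr1; last first.
    by move=> i _; rewrite /= /bump /=; do 2 (case: ifP => [|_]; first lia).
  by congr (_ * _); apply: eq_bigr => i _; rewrite ltn_ord.
rewrite -(Dt_scale _ (fun i => ((m + i)`!)%:R / ((b + i)`!)%:R)).
apply: eq_Dt => j i _ _.
have mi : (m + i = d + (b + i))%N by lia.
rewrite /lower_mx /falling_mx /upper_factor /low_col !bin_rfact mi !rfact_shift.
case: (ltngtP j n') => jn.
- by field; rewrite !fact_neq0.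
- have -> : (e + (d + (b + i)) = (e + d) + (b + i))%N by lia.
  have -> : (d + (b + i) + e = (e + d) + (b + i))%N by lia.
  rewrite !ffactE rfact_shift.
  by field; rewrite !fact_neq0.
- rewrite addnS !natr_factS natrM.
  have h1 : (d + n').+1%:R != 0 :> rat by rewrite pnatr_eq0.
  have h2 : n%:R != 0 :> rat by rewrite pnatr_eq0.
  rewrite [(n + d)%N]addnC addnS.
  move: (e%:R) ((d + n').+1%:R) (n%:R) h1 h2 => x y z h1 h2.
  by field; rewrite !fact_neq0 h1 h2.
Qed.

(** This is [ffact_rising] with [t = b + i] and [h = d + e], for which [t + h = m + i + e]. Earlier
    columns clear the lower rising factorials, except the one of the missing degree [a'] in the last
    column. *)
Lemma Dt_falling_rising : Dt (n' + a'.+2) falling_mx = Dt (n' + a'.+2) rising_mx.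
Proof.
apply: (@Dt_colops n) => j.
  by move=> i jn _ _; rewrite /falling_mx /rising_mx -ltnS jn.
rewrite !addSn addnS ltnS ltn_add2l ltnS => ja.
exists (frc (d + e) (gap j)) => i _.
rewrite /falling_mx /rising_mx ltnNge leq_addr /= -addSn addKn.
have -> : ((m + i + e)`!)%:R / ((m + i)`!)%:R * ((b + i) ^_ (gap j))%:R
    = (\sum_(l < (gap j).+1) frc (d + e) (gap j) l * ((m + i + (e + l))`!)%:R) / ((m + i)`!)%:R :> rat.
  rewrite mulrAC; congr (_ / _).
  have -> : (m + i + e = (b + i) + (d + e))%N by lia.
  rewrite mulrC ffact_rising; apply: eq_bigr => l _.
  by do 3 f_equal; lia.
have E (k : nat) : (k <= a')%N ->
   (\sum_(l < k) frc (d + e) (gap j) l * ((m + i + (e + l))`!)%:R) / ((m + i)`!)%:R =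
   \sum_(l < k) frc (d + e) (gap j) l *
      (if (n + l <= n')%N then low_col (n + l) i
       else if (n + l - n < a')%N then ((m + i + (e + (n + l - n)))`!)%:R / ((m + i)`!)%:R
       else 1 * (((m + i + (e + a))`!)%:R / ((m + i)`!)%:R) + 
         (- (a%:R * (d + e + a)%:R)) * (((m + i + (e + a'))`!)%:R / ((m + i)`!)%:R)).
  move=> ka; rewrite mulr_suml; apply: eq_bigr => l _.
  rewrite addKn (leq_trans (ltn_ord l) ka) leqNgt addSn ltnS leq_addr /=.
  by rewrite mulrA.
move: ja; rewrite leq_eqVlt => /orP [/eqP ej | ja].
  rewrite -E; last by lia.
  have -> : gap j = a by rewrite /gap ej ltnn.
  rewrite ej ltnn !big_ord_recr /= frc_subdiag frc_diag.
  by ring.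
rewrite -E; last by lia.
have -> : gap j = j by rewrite /gap ja.
rewrite ja big_ord_recr /= frc_diag.
by ring.
Qed.

End LowerBlock.

(** * Reduction to a 2x2 determinant *)

Section RisingBlock.

Variables n' a' b c d : nat.
Local Notation n := n'.+1.
Local Notation a := a'.+1.
Local Notation e := (n + c)%N.
Local Notation m := (b + d)%N.

(** [special_row] and [last_row] are the columns of the final 2x2 determinant: the [a']-th
    differences of the first column of [reduced_mx], up to the sign [(-1) ^+ a'], and of its last
    column. *)
Definition special_row (i : nat) : rat :=
  rfac c a' * (n * (m + n' + i).+1 + (n + d) * (c + a'))%:R * ((m + n' + i)`!)%:R
  / ((m + n' + i + c + a').+1`!)%:R.

Definition last_row (i : nat) : rat :=
  ((e + a)`!)%:R / ((c + a).+1`!)%:R * (a`!)%:R * (m + e + a + i)%:R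
  - a%:R * (d + e + a)%:R * (((e + a')`!)%:R / ((c + a').+1`!)%:R * (a'`!)%:R).

Definition reduced_mx (j i : nat) : rat :=
  if j == 0%N then
    (n * (m + n' + i).+1 + (n + d) * c)%:R * ((m + n' + i)`!)%:R
    / ((m + n' + i + c).+1`!)%:R
  else if (j <= a')%N then ('C(m + e + j.-1 + i, j.-1))%:R
  else ((e + a)`!)%:R / ((c + a).+1`!)%:R * (a`!)%:R * ('C(m + e + a + i, a' + 1))%:R
    + (- (a%:R * (d + e + a)%:R * (((e + a')`!)%:R / ((c + a').+1`!)%:R * (a'`!)%:R)))
      * ('C(m + e + a' + i, a' + 0))%:R.

Definition reduced_factor (j : nat) : rat :=
  if j is k.+1 then
    if (k < a')%N then ((e + k)`!)%:R * (k`!)%:R / ((c + k).+1`!)%:R else 1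
  else 1.

(** Taking [n'] differences removes the binomial columns. Dividing row [i] by
    [(m + i + e)! / (m + i + n')!] then makes the rising columns polynomial in [i], at the price of
    a rational first column. *)
Lemma Dt_rising_reduced :
  Dt (n' + a'.+2) (rising_mx n' a' b c d) =
  (\prod_(i < a'.+2) (((m + i + e)`!)%:R / ((m + i + n')`!)%:R))
  * (\prod_(k < a') (((e + k)`!)%:R * (k`!)%:R / ((c + k).+1`!)%:R))
  * Dt a'.+2 reduced_mx.
Proof.
rewrite (@Dt_bin b); last first.
  by move=> j i jn; rewrite /rising_mx (ltnW jn) /low_col jn.
have -> : \prod_(k < a') (((e + k)`!)%:R * (k`!)%:R / ((c + k).+1`!)%:R)
   = \prod_(j < a'.+2) reduced_factor j.
  rewrite big_ord_recl big_ord_recr /= ltnn mul1r mulr1.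
  by apply: eq_bigr => k _; rewrite /= ltn_ord.
rewrite -(Dt_scale _ (fun i => ((m + i + e)`!)%:R / ((m + i + n')`!)%:R)).
apply: eq_Dt => j i; rewrite ltnS => ja _.
have ratio (k : nat) : ((m + i + (e + k))`!)%:R / ((m + i + n')`!)%:R
    = ((m + i + e)`!)%:R / ((m + i + n')`!)%:R * (k`!)%:R * ('C(m + e + k + i, k))%:R :> rat.
  have -> : (m + e + k + i = k + (m + i + e))%N by lia.
  have -> : (m + i + (e + k) = k + (m + i + e))%N by lia.
  by rewrite binE; field; rewrite !fact_neq0.
have ek (k : nat) : (e + k = n' + (c + k).+1)%N by lia.
have iterR (k : nat) : iter n' Delta (fun i => ((m + i + (e + k))`!)%:R / ((m + i)`!)%:R) i
   = ((e + k)`!)%:R / ((c + k).+1`!)%:R * (((m + i + (e + k))`!)%:R / ((m + i + n')`!)%:R).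
  by rewrite ek iter_Delta_fact_ratio.
case: j ja => [|k] ja.
  rewrite (@eq_iter_Delta n' _ (fun i => n%:R * ('C(b + i, n' + 1))%:R
     + (e * (n + d))%:R * ('C(b + i, n' + 0))%:R)); last first.
    by move=> x; rewrite /rising_mx /low_col !addn0 leqnn ltnn addn1.
  rewrite iter_Delta_lin !iter_Delta_bin bin1 bin0 /reduced_mx /= mulr1.
  have -> : (m + n' + i = m + i + n')%N by lia.
  have -> : ((m + i + n' + c).+1 = m + i + e)%N by lia.
  rewrite mulrA -[RHS]mulrA [RHS]mulrAC.
  have -> : (n * (m + i + n').+1 + (n + d) * c = n * (b + i) + e * (n + d))%N by lia.
  rewrite natrD !natrM; field; rewrite !fact_neq0 //.
rewrite ltnS in ja; rewrite addnS /reduced_mx /= /reduced_factor.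
have [ka | ak] := ltnP k a'.
  rewrite (@eq_iter_Delta n' _ (fun i => ((m + i + (e + k))`!)%:R / ((m + i)`!)%:R)); last first.
    by move=> x; rewrite /rising_mx ltnNge leq_addr -addSn addKn ka.
  by rewrite iterR ratio; field; rewrite !fact_neq0.
have -> : k = a' by lia.
rewrite (@eq_iter_Delta n' _ (fun i => 1 * (((m + i + (e + a))`!)%:R / ((m + i)`!)%:R) + 
       (- (a%:R * (d + e + a)%:R)) * (((m + i + (e + a'))`!)%:R / ((m + i)`!)%:R))); last first.
  by move=> x; rewrite /rising_mx ltnNge leq_addr -addSn addKn ltnn.
rewrite iter_Delta_lin !iterR !ratio addn1 addn0.
by field; rewrite !fact_neq0.
Qed.

Lemma Dt_reduced : Dt a'.+2 reduced_mx =
  special_row 0 * last_row 1 - last_row 0 * special_row 1.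
Proof.
rewrite -[a'.+2]/(a'.+1).+1 -[a'.+1]addn1 (@Dt_bin_swap (m + e)); last first.
  by move=> j i ja; rewrite /reduced_mx /= ja.
have hS i : iter a' Delta (reduced_mx 0) i = (-1) ^+ a' * special_row i.
  by rewrite iter_Delta_special /special_row !mulrA.
have hT i : iter a' Delta (reduced_mx a'.+1) i = last_row i.
  rewrite (@eq_iter_Delta a' _ (fun i =>
    ((e + a)`!)%:R / ((c + a).+1`!)%:R * (a`!)%:R * ('C(m + e + a + i, a' + 1))%:R
    + (- (a%:R * (d + e + a)%:R * (((e + a')`!)%:R / ((c + a').+1`!)%:R * (a'`!)%:R)))
      * ('C(m + e + a' + i, a' + 0))%:R)); last first.
    by move=> x; rewrite /reduced_mx /= ltnn.
  by rewrite iter_Delta_lin !iter_Delta_bin bin1 bin0 mulr1.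
rewrite Dt2 /= addn1 !hS !hT.
(* One sign comes from moving the special column past [a'] others, the second from its [a']-th
   difference. *)
have : (-1) ^+ a' * (-1) ^+ a' = 1 :> rat by rewrite -expr2 sqrr_sign.
move: ((-1) ^+ a') => s hs.
transitivity ((s * s) * (special_row 0 * last_row 1 - last_row 0 * special_row 1)).
  by ring.
by rewrite hs mul1r.
Qed.

End RisingBlock.

(** * Superfactorials and the Aitken matrix of the given shape *)

Lemma PhiS k : (Phi k.+1)%:R = (Phi k)%:R * (k`!)%:R :> rat.
Proof.
case: k => [|k]; first by rewrite /Phi !big_geq // mulr1.
by rewrite /Phi big_nat_recr //= natrM.
Qed.

Lemma Phi_neq0 k : (Phi k)%:R != 0 :> rat.
Proof.
elim: k => [|k IH]; first by rewrite /Phi big_geq ?oner_neq0.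
by rewrite PhiS mulf_neq0 ?fact_neq0.
Qed.

Lemma prod_fact p k : \prod_(i < k) ((p + i)`!)%:R = (Phi (p + k))%:R / (Phi p)%:R :> rat.
Proof.
elim: k => [|k IH]; first by rewrite big_ord0 addn0 divff ?Phi_neq0.
by rewrite big_ord_recr /= IH addnS PhiS mulrAC.
Qed.

Lemma prod_fact0 k : \prod_(i < k) (i`!)%:R = (Phi k)%:R :> rat.
Proof.
have := prod_fact 0 k; rewrite add0n => ->.
by rewrite [X in _ / X](_ : _ = 1) ?divr1 // /Phi big_geq.
Qed.

(** The parts of the two partitions counted from the bottom, with [mu] padded by zeros to
    [n + a + d] rows. *)
Definition lambda_row (n b c d r : nat) : nat := if (r < d)%N then (n + c)%N else (n + b + c)%N.

Definition mu_row (n a c d r : nat) : nat :=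
  if (r.+1 < n + d)%N then 0%N else if r.+1 == (n + d)%N then 1%N
  else if r.+1 == (n + a + d)%N then c.+1 else c.

Section ShapeDet.

Variables n a' b c d q : nat.
Local Notation a := a'.+1.
Local Notation e := (n + c)%N.
Local Notation m := (b + d)%N.
Hypothesis qE : q.+1 = (n + d)%N.

(** The beta-numbers of lambda are [e + beta i]. *)
Definition beta (i : nat) : nat := if (i < d)%N then i else (b + i)%N.

Definition vandermonde_mx (j i : nat) : rat :=
  if (j < q)%N then ('C(beta i, j))%:R
  else if j == q then ('C(beta i, q.+1))%:R + e%:R * ('C(beta i, q))%:R
  else ((e + beta i) ^_ (e + d + gap a' (j - q.+1)))%:R.

Lemma det_aitken_vandermonde :
  \det (aitken_mx (n + a + d) (lambda_row n b c d) (mu_row n a c d)) =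
  (Phi e)%:R / (Phi (e + d))%:R * ((Phi (e + m))%:R / (Phi (e + m + (n + a)))%:R)
  * (Phi q)%:R * (q.+1`!)%:R * Dt (d + (n + a)) vandermonde_mx.
Proof.
pose eta j := (mu_row n a c d j + j)%N.
have eta_lt j : (j < q)%N -> eta j = j.
  by move=> h; rewrite /eta /mu_row -qE ltnS h.
have eta_q : eta q = q.+1 by rewrite /eta /mu_row -qE ltnn eqxx.
have -> : \det (aitken_mx (n + a + d) (lambda_row n b c d) (mu_row n a c d)) =
    Dt (q.+1 + a) (fun j i => rfact (e + beta i) (eta j)).
  have -> : (q.+1 + a = n + a + d)%N by lia.
  rewrite -[LHS]/(Dt (n + a + d) (fun j i => rfact (lambda_row n b c d i + i) (eta j))).
  apply: eq_Dt => j i _ _; congr rfact.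
  by rewrite /lambda_row /beta; case: ifP => _; lia.
rewrite Dt_rfact_low // prod_fact0; congr (_ * _ * _ * _).
  have -> : (q.+1 + a = d + (n + a))%N by lia.
  rewrite (prod_ord_add _ _ (fun i => ((e + beta i)`!)%:R)).
  under eq_bigr do rewrite /beta ltn_ord.
  under [X in (_ * X)^-1]eq_bigr => i _.
    rewrite /beta ltnNge leq_addr /= (_ : (e + (b + (d + i)) = e + m + i)%N); last by lia.
    over.
  by rewrite !prod_fact invfM !invf_div.
have -> : (q.+1 + a = d + (n + a))%N by lia.
apply: eq_Dt => j i jN _; rewrite /vandermonde_mx.
case: (ltngtP j q) => // qj; congr ((_ ^_ _)%:R).
rewrite /eta /mu_row /gap.
by do ![case: ifP => ? //=; try lia]; lia.
Qed.

End ShapeDet.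

Lemma beta_add b d i : beta b d (d + i) = (b + d + i)%N.
Proof. by rewrite /beta ltnNge leq_addr /= addnA. Qed.

(** In the first [d] rows [beta i = i], so the columns of degree at least [d] vanish there and the
    others form a unitriangular block. For positive [n] the special column, number [n' + d], is
    among the vanishing ones. *)
Lemma Dt_vandermonde_pos n' a' b c d :
  Dt (d + (n'.+1 + a'.+1)) (vandermonde_mx n'.+1 a' b c d (n' + d)) =
  Dt (n' + a'.+2) (lower_mx n' a' b c d).
Proof.
rewrite Dt_block => [|j i id /andP [dj jN]].
  rewrite Dt_trig => [|j i ij jd].
    rewrite big1 ?mul1r => [|i _].
      rewrite (_ : (n'.+1 + a'.+1 = n' + a'.+2)%N); last by lia.
      apply: eq_Dt => j i _ _; rewrite /vandermonde_mx /lower_mx beta_add.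
      have -> : (d + j - (n' + d).+1 = j - n'.+1)%N by lia.
      rewrite [(n' + d)%N]addnC ltn_add2l eqn_add2l -addnS.
      by case: (ltngtP j n').
    rewrite /vandermonde_mx /beta ltn_ord (_ : (i < n' + d)%N) ?binn //.
    by have := ltn_ord i; lia.
  rewrite /vandermonde_mx /beta (ltn_trans ij jd) (_ : (j < n' + d)%N) ?bin_small //.
  by lia.
rewrite /vandermonde_mx /beta id; case: (ltngtP j (n' + d)%N) => h.
- by rewrite bin_small // (leq_trans id).
- by rewrite ffact_small //; lia.
- by rewrite !bin_small ?mulr0 ?addr0 //; lia.
Qed.

(** For [n = 0] the special column is the last one of the first block and contributes the diagonal
    entry [c]. In the other block [a'] differences leave a single entry, a multiple of [b]. *)
Lemma Dt_vandermonde0 a' b c d' :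
  Dt (d'.+1 + (0 + a'.+1)) (vandermonde_mx 0 a' b c d'.+1 d') =
  c%:R * ((\prod_(i < a'.+1) (((b + d'.+1 + c + i)`!)%:R / ((b + i)`!)%:R))
  * (\prod_(k < a') (k`!)%:R) * ((a'.+1`!)%:R * b%:R)).
Proof.
rewrite Dt_block => [|j i id /andP [dj jN]]; last first.
  rewrite /vandermonde_mx /beta id; case: (ltngtP j d') => h; [lia | | lia].
  by rewrite ffact_small //; lia.
congr (_ * _).
  rewrite Dt_trig => [|j i ij jd].
    rewrite big_ord_recr /= big1 ?mul1r => [|i _].
      rewrite /vandermonde_mx /beta ltnn eqxx ltnSn binn bin_small // add0r mulr1.
      by rewrite add0n.
    rewrite /vandermonde_mx /beta ltn_ord /= ltnS (ltnW (ltn_ord i)).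
    by rewrite binn.
  rewrite /vandermonde_mx /beta (ltn_trans ij jd).
  case: (ltngtP j d') => h; [|lia|]; rewrite !bin_small ?mulr0 ?addr0 //; lia.
rewrite add0n.
have -> : \prod_(k < a') (k`!)%:R = \prod_(k < a'.+1) (if (k < a')%N then (k`!)%:R else 1) :> rat.
  rewrite big_ord_recr /= ltnn mulr1; apply: eq_bigr => k _.
  by rewrite ltn_ord.
pose F (j i : nat) : rat := if (j < a')%N then ('C(b + i, j))%:R
   else (a'.+1`!)%:R * ('C(b + i, a' + 1))%:R + 0 * ('C(b + i, a' + 1))%:R.
have -> : (a'.+1`!)%:R * b%:R = Dt a'.+1 F.
  rewrite -addn1 (@Dt_bin b) => [|j i ja]; last by rewrite /F ja.
  rewrite Dt1 addn0.
  rewrite (@eq_iter_Delta a' _ (fun i => (a'.+1`!)%:R * ('C(b + i, a' + 1))%:R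
    + 0 * ('C(b + i, a' + 1))%:R)); last by move=> i; rewrite /F ltnn.
  by rewrite iter_Delta_lin mul0r addr0 iter_Delta_bin bin1 addn0 addn1.
rewrite -(Dt_scale _ (fun i => ((b + d'.+1 + c + i)`!)%:R / ((b + i)`!)%:R)
   (fun k => if (k < a')%N then (k`!)%:R else 1)).
apply: eq_Dt => j i ja _; rewrite /vandermonde_mx beta_add addSn ltnNge.
rewrite (leq_trans (leq_addr _ _) (leqnSn _)) /= gtn_eqF ?ltnS ?leq_addr //.
rewrite subSS addKn add0n.
have -> : (c + (b + d'.+1 + i) = (c + d'.+1) + (b + i))%N by lia.
have -> : (b + d'.+1 + c + i = (c + d'.+1) + (b + i))%N by lia.
rewrite ffactE rfact_shift /F /gap; case: ifP => h; rewrite bin_rfact.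
  by field; rewrite !fact_neq0.
rewrite (_ : j = a'); last by lia.
by rewrite addn1 mul0r addr0; field; rewrite !fact_neq0.
Qed.

(** * Collecting the factors *)

Lemma Phi_quotientE n a b c d : Phi_quotient n a b c d =
  (Phi n)%:R * (Phi a)%:R * (Phi b)%:R * (Phi c)%:R * (Phi d)%:R * (Phi (n + a + c))%:R
  * (Phi (n + b + d))%:R * (Phi (n + a + b + c + d))%:R
  / ((Phi (a + c))%:R * (Phi (b + d))%:R * (Phi (n + a + b))%:R * (Phi (n + c + d))%:R
     * (Phi (2 * n + a + b + c + d))%:R).
Proof. by rewrite /Phi_quotient !natrM. Qed.

Section PositiveCase.

Variables n' a' b c d : nat.
Local Notation n := n'.+1.
Local Notation a := a'.+1.

Lemma det_aitken_pos :
  \det (aitken_mx (n + a + d) (lambda_row n b c d) (mu_row n a c d)) =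
  Phi_quotient n a b c d *
  (((b + d + (n + c) + a)`!)%:R * (c`!)%:R
     / (((b + d + n')`!)%:R * ((n + c + a')`!)%:R * (a'`!)%:R)
   * (special_row n' a' b c d 0 * last_row n' a' b c d 1
      - last_row n' a' b c d 0 * special_row n' a' b c d 1)).
Proof.
rewrite (@det_aitken_vandermonde _ _ _ _ _ (n' + d)) //.
rewrite Dt_vandermonde_pos Dt_lower_falling Dt_falling_rising Dt_rising_reduced.
rewrite Dt_reduced.
set X := (_ - _ : rat).
have Eu : \prod_(i < n' + a'.+2) (((b + d + i)`!)%:R / ((b + i)`!)%:R)
   = (Phi (b + d + n + a))%:R / (Phi (b + d))%:R / ((Phi (b + n + a))%:R / (Phi b)%:R) :> rat.
  rewrite prodf_div !prod_fact.
  have -> : (b + d + (n' + a'.+2) = b + d + n + a)%N by lia.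
  by have -> : (b + (n' + a'.+2) = b + n + a)%N by lia.
have El : \prod_(j < n') ((j`!)%:R / ((d + j)`!)%:R)
   = (Phi n')%:R / ((Phi (n' + d))%:R / (Phi d)%:R) :> rat.
  by rewrite prodf_div prod_fact0 prod_fact addnC.
(* The product has [a + 1] factors, so one factorial is split off to reach the superfactorial in
   [Phi_quotient]. *)
have Er : \prod_(i < a'.+2) (((b + d + i + (n + c))`!)%:R / ((b + d + i + n')`!)%:R)
   = (Phi (b + d + (n + c) + a))%:R * ((b + d + (n + c) + a)`!)%:R / (Phi (b + d + (n + c)))%:R
     / ((Phi (b + d + n + a))%:R / (Phi (b + d + n'))%:R) :> rat.
  rewrite prodf_div.
  under eq_bigr do rewrite addnAC.
  under [X in _ / X = _]eq_bigr do rewrite addnAC.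
  rewrite !prod_fact -PhiS.
  have -> : (b + d + n' + a'.+2 = b + d + n + a)%N by lia.
  by rewrite !addnS.
have Ec : \prod_(k < a') (((n + c + k)`!)%:R * (k`!)%:R / ((c + k).+1`!)%:R)
   = (Phi (n + c + a'))%:R / (Phi (n + c))%:R * (Phi a')%:R
     / ((Phi (a + c))%:R / ((Phi c)%:R * (c`!)%:R)) :> rat.
  rewrite prodf_div big_split /= prod_fact0 prod_fact.
  under [X in _ / X = _]eq_bigr do rewrite -addSn.
  by rewrite prod_fact -PhiS (_ : (c.+1 + a' = a + c)%N) //; lia.
rewrite Eu El Er Ec {Eu El Er Ec} Phi_quotientE.
have E1 : (Phi n)%:R = (Phi n')%:R * (n'`!)%:R :> rat by rewrite PhiS.
have E2 : (Phi a)%:R = (Phi a')%:R * (a'`!)%:R :> rat by rewrite PhiS.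
have E3 : (Phi (n + b + d))%:R = (Phi (b + d + n'))%:R * ((b + d + n')`!)%:R :> rat.
  by rewrite -PhiS; do 2 f_equal; lia.
have E4 : (Phi (n + a + c))%:R = (Phi (n + c + a'))%:R * ((n + c + a')`!)%:R :> rat.
  by rewrite -PhiS; do 2 f_equal; lia.
have -> : (n + a + b + c + d = b + d + (n + c) + a)%N by lia.
have -> : (2 * n + a + b + c + d = n + c + (b + d) + (n + a))%N by lia.
have -> : (n + c + (b + d) = b + d + (n + c))%N by lia.
have -> : (n + a + b = b + n + a)%N by lia.
have -> : ((n' + d).+1 = d + n)%N by lia.
rewrite E1 E2 E3 E4.
by field; rewrite !fact_neq0 !Phi_neq0.
Qed.

(** Once the factorials are reduced to common smallest ones, this is an identity of rational
    functions. The factor [rfac c a' * c! / (c + a')!] stands for [c / (a + c - 1)], and takes the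
    value 1 at [(a, c) = (1, 0)]. *)
Lemma quartic_factorE :
  ((b + d + (n + c) + a)`!)%:R * (c`!)%:R
     / (((b + d + n')`!)%:R * ((n + c + a')`!)%:R * (a'`!)%:R)
   * (special_row n' a' b c d 0 * last_row n' a' b c d 1
      - last_row n' a' b c d 0 * special_row n' a' b c d 1)
  = rfac c a' * (c`!)%:R / ((c + a')`!)%:R * a%:R
    * (quartic_factor n a b c d / ((a + c)%:R + 1)).
Proof.
rewrite /special_row /last_row !addn0 !addn1.
have -> : (b + d + (n + c) + a = (b + d + n' + c + a').+2)%N by lia.
have -> : ((b + d + n').+1 + c + a').+1 = (b + d + n' + c + a').+2 by lia.
have -> : (n + c + a = (n + c + a').+1)%N by lia.
have -> : (c + a = (c + a').+1)%N by lia.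
rewrite (natr_factS (b + d + n' + c + a').+1) (natr_factS (b + d + n' + c + a')).
rewrite (natr_factS (n + c + a')) (natr_factS (c + a').+1) (natr_factS (c + a')).
rewrite (natr_factS (b + d + n')) (natr_factS a') /quartic_factor.
have h1 : (b + d + n' + c + a').+2%:R != 0 :> rat by rewrite pnatr_eq0.
have h2 : (b + d + n' + c + a').+1%:R != 0 :> rat by rewrite pnatr_eq0.
have h3 : (c + a').+2%:R != 0 :> rat by rewrite pnatr_eq0.
have h4 : (c + a').+1%:R != 0 :> rat by rewrite pnatr_eq0.
move: (fact_neq0 (b + d + n' + c + a')) (fact_neq0 (b + d + n')) (fact_neq0 (n + c + a'))
  (fact_neq0 a') (fact_neq0 (c + a')).
move: ((b + d + n' + c + a')`!) ((b + d + n')`!) ((n + c + a')`!) (a'`!) ((c + a')`!) (c`!) (rfac c a')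
  => f1 f2 f3 f4 f5 f6 r hf1 hf2 hf3 hf4 hf5.
move: h1 h2 h3 h4; rewrite !(natrD, natrM, =^~ natr1) => h1 h2 h3 h4.
field; rewrite hf1 hf2 hf3 hf4 hf5 h1 h2 h4 andbT /=.
by rewrite (_ : a'%:R + 1 + c%:R + 1 = c%:R + a'%:R + 1 + 1) ?h3 //; ring.
Qed.

End PositiveCase.

Lemma det_aitken0 a' b c d' :
  \det (aitken_mx (0 + a'.+1 + d'.+1) (lambda_row 0 b c d'.+1) (mu_row 0 a'.+1 c d'.+1)) =
  Phi_quotient 0 a'.+1 b c d'.+1 * (a'.+1%:R * b%:R * c%:R * d'.+1%:R).
Proof.
rewrite (@det_aitken_vandermonde _ _ _ _ _ d') // Dt_vandermonde0.
rewrite prodf_div prod_fact0 !prod_fact Phi_quotientE muln0 !add0n.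
have -> : (c + (b + d'.+1) = b + d'.+1 + c)%N by lia.
have -> : (a'.+1 + b + c + d'.+1 = b + d'.+1 + c + a'.+1)%N by lia.
have -> : (a'.+1 + b = b + a'.+1)%N by lia.
have Phi0 : (Phi 0)%:R = 1 :> rat by rewrite /Phi big_geq.
rewrite Phi0 !(PhiS a') !(PhiS d') (natr_factS a') (natr_factS d').
by field; rewrite !Phi_neq0.
Qed.

Lemma rfac_fact c k : rfac c.+1 k * (c`!)%:R = ((c + k)`!)%:R.
Proof.
elim: k => [|k IH]; first by rewrite /rfac big_ord0 mul1r addn0.
by rewrite /rfac big_ord_recr /= mulrAC IH addnS natr_factS mulrC addSn.
Qed.

(** * From the diagrams to the determinant *)

Lemma mem_diagram s p :
  (p \in diagram s) = [&& 0 < p.1, p.1 <= size s, 0 < p.2 & p.2 <= nth 0 s p.1.-1]%N.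
Proof.
rewrite /diagram in_fset; apply/allpairsPdep/idP => [[i [j [hi hj ->]]] | h].
  by move: hi hj; rewrite !mem_iota /=; lia.
exists p.1, p.2; rewrite !mem_iota; split; [lia | lia | by case: (p)].
Qed.

Lemma nth_lambda_shape n a b c d p : (p < n + a + d)%N ->
  nth 0%N (lambda_shape n a b c d) p = lambda_row n b c d (n + a + d - p.+1).
Proof.
move=> pN; rewrite /lambda_shape /lambda_row nth_cat size_nseq !nth_nseq.
by do ![case: ifP => ? //]; lia.
Qed.

Lemma nth_mu_shape n a c d p : (0 < a)%N -> (0 < n + d)%N -> (p < n + a + d)%N ->
  nth 0%N (mu_shape a c) p = mu_row n a c d (n + a + d - p.+1).
Proof.
move=> a0 nd pN; rewrite /mu_row (_ : (n + a + d - p.+1).+1 = n + a + d - p)%N; last by lia.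
rewrite /mu_shape; case: p pN => [|p] pN /=.
  rewrite subn0 eqxx; by do ![case: ifP => ? //]; lia.
rewrite nth_cat size_nseq nth_nseq; case: ifP => h.
  by do ![case: ifP => ? //]; lia.
case E: (p - a.-1)%N => [|k] /=; last rewrite nth_nil; by do ![case: ifP => ? //]; lia.
Qed.

Lemma partition_mu_shape a c : (1 <= a)%N -> is_partition (mu_shape a c) ->
  (a = 1 \/ 0 < c)%N.
Proof.
case: a => [|[|a]] // _; first by left.
rewrite /is_partition /mu_shape /= => /andP [_ /order_path_min h]; right.
have /allP /(_ 1%N) : all (geq c) (nseq a c ++ [:: 1%N]).
  by apply: h => x y z /= h1 h2; lia.
by rewrite mem_cat inE eqxx orbT => /(_ isT).
Qed.

(* At (a, c) = (1, 0) the factor ac / (a+c-1) reads 0 / 0; for a = 1 it equals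
   c / c, and there it is read as 1. *)
Theorem theorem3p1 (n a b c d : nat) :
  (1 <= a)%N ->
  let la := lambda_shape n a b c d in
  let mu := mu_shape a c in
  let rho := skew_shape la mu in
  is_partition mu ->
  (diagram mu `<=` diagram la)%fset ->
  (num_SYT rho)%:R =
    ((#|` rho|)`!)%:R * Phi_quotient n a b c d
    * (if (a == 1%N) && (c == 0%N)
       then quartic_factor n a b c d / ((a + c)%:R + 1)
       else (a * c)%:R * quartic_factor n a b c d
            / (((a + c)%:R - 1) * ((a + c)%:R + 1))) :> rat.
Proof.
move=> a0 la mu rho part sub.
have sizela : size la = (n + a + d)%N by rewrite size_cat !size_nseq.
have sizemu : size mu = a.+1 by rewrite /= size_cat size_nseq /=; lia.
have ac := partition_mu_shape a0 part.
(* Containment is applied to two cells: the last part of [mu], which yields [n + d > 0], and the end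
   of its first row. *)
have : (a.+1, 1%N) \in diagram la.
  move/fsubsetP: sub; apply; rewrite mem_diagram sizemu ltnSn /= /mu /mu_shape.
  by case: (a) a0 => // k _; rewrite /= nth_cat size_nseq ltnn subnn.
rewrite mem_diagram sizela /= => /andP [aN].
rewrite nth_lambda_shape // => la_a.
have nd : (0 < n + d)%N by lia.
have : (1%N, c.+1) \in diagram la.
  by move/fsubsetP: sub; apply; rewrite mem_diagram sizemu /=.
rewrite mem_diagram sizela /= => /andP [_].
rewrite nth_lambda_shape; last by lia.
move: la_a; rewrite /lambda_row => la_a la_0.
have la_mono i j : (i <= j)%N -> (j < n + a + d)%N ->
    (lambda_row n b c d i <= lambda_row n b c d j)%N.
  by rewrite /lambda_row => ij _; do ![case: ifP => ? //]; lia.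
have mu_mono i j : (i <= j)%N -> (j < n + a + d)%N ->
    (mu_row n a c d i <= mu_row n a c d j)%N.
  by rewrite /mu_row => ij jN; do ![case: ifP => ? //]; lia.
have mula i : (i < n + a + d)%N -> (mu_row n a c d i <= lambda_row n b c d i)%N.
  move: la_a la_0; rewrite /mu_row /lambda_row => + + iN.
  by do ![case: ifP => ? //]; lia.
have skew : is_skew (n + a + d) (mu_row n a c d) (lambda_row n b c d) (enum_fset rho).
  move=> [p q]; rewrite -[LHS]/((p, q) \in rho) in_fsetD !mem_diagram sizela sizemu.
  have [/andP [p0 pN] | h] := boolP ((0 < p) && (p <= n + a + d))%N; last first.
    by move: h; rewrite negb_and => /orP [] /negbTE ->; rewrite ?andbF.
  have pN' : (p.-1 < n + a + d)%N by lia.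
  rewrite /= (nth_lambda_shape _ _ pN') (nth_mu_shape c a0 nd pN') prednK //.
  (* Beyond the [a + 1] parts of [mu] the padding by zeros agrees with the absence of cells. *)
  have : (a.+1 < p)%N -> mu_row n a c d (n + a + d - p) = 0%N.
    by move=> h; rewrite /mu_row; case: ifP => //; lia.
  move: (mu_row _ _ _ _ _) (lambda_row _ _ _ _ _) => M L; lia.
rewrite num_SYT_linext (aitken mu_mono la_mono mula (fset_uniq rho) skew).
rewrite -mulrA; congr (_ * _).
clear - a0 nd ac.
case: a a0 ac => // a' _ ac.
have ac_neq0 : ~~ ((a'.+1 == 1%N) && (c == 0%N)) -> a'%:R + c%:R != 0 :> rat.
  by move=> h; rewrite -natrD pnatr_eq0; lia.
have ac1_neq0 : a'%:R + 1 + c%:R + 1 != 0 :> rat.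
  by rewrite !natr1 -natrD natr1 pnatr_eq0.
case: n nd => [|n'] nd.
  case: d nd => // d' _; rewrite det_aitken0 /quartic_factor; congr (_ * _).
  (* For [n = 0] both sides vanish at [(a, c) = (1, 0)]. *)
  case: ifPn => [/andP [/eqP [->] /eqP ->] | /ac_neq0 h].
    by rewrite !mul0n; ring.
  rewrite !mul0n !(natrD, natrM, =^~ natr1); field.
  by rewrite ac1_neq0 (_ : _ - 1 = a'%:R + c%:R) ?h //; ring.
rewrite det_aitken_pos quartic_factorE; congr (_ * _).
case: ifPn => [/andP [/eqP [->] /eqP ->] | h].
  by rewrite /rfac big_ord0 addn0 divr1 !mul1r.
(* As [a = 1] or [c > 0], excluding [(1, 0)] leaves [c > 0], and [rfac_fact] applies to the
   predecessor of [c]. *)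
case: c ac h ac_neq0 ac1_neq0 => [|c'] ac h /(_ h) ac_neq0 ac1_neq0; first by lia.
have := rfac_fact c' a'; rewrite addSn !natr_factS => <-.
move: (quartic_factor _ _ _ _ _) => Q.
have := fact_neq0 (c' + a'); rewrite -rfac_fact mulf_eq0 negb_or => /andP [h1 h2].
move: (rfac _ _) (c'`!) h1 h2 => r f h1 h2.
move: ac_neq0 ac1_neq0; rewrite !(natrD, natrM, =^~ natr1) => h4 h5.
field; rewrite h1 h2 h5 andbT /=.
by rewrite (_ : _ - 1 = a'%:R + (c'%:R + 1)) ?h4 //; ring.
Qed.
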